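(* For every prime $m\geq 3$, the Cartesian product graph $\Gamma(\mathbb{Z}_6)\times\Gamma(\mathbb{Z}_{m^2})$ admits a distance antimagic labeling.
   Context: For an integer $n \geq 2$, the zero-divisor graph $\Gamma(\mathbb{Z}_n)$ is the simple graph whose vertex set is the set of nonzero zero-divisors of the ring $\mathbb{Z}_n$, two distinct vertices $u,v$ being adjacent iff $uv \equiv 0 \pmod n$. The Cartesian product $G\times H$ has vertex set $V(G)\times V(H)$, with $(u,v)$ adjacent to $(u',v')$ iff either $u=u'$ and $vv'\in E(H)$, or $v=v'$ and $uu'\in E(G)$. A distance antimagic labeling (DAML) of a graph $G$ with $N$ vertices is a bijection $f:V(G)\to\{1,\dots,N\}$ such that the weights $w(v)=\sum_{u\in N(v)} f(u)$, where $N(v)$ is the open neighbourhood of $v$, are pairwise distinct over all vertices $v$. A graph admits DAML if such a labeling exists. *)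

(* Defs.v *)
From HB Require Import structures.
From mathcomp Require Import all_boot all_order all_algebra.

Set Implicit Arguments.
Unset Strict Implicit.
Unset Printing Implicit Defensive.

Import GRing.Theory.
Local Open Scope ring_scope.

Record sgraph := SGraph {
  svertex :> finType;
  sadj : rel svertex;
  sadj_sym : symmetric sadj;
  sadj_irrefl : irreflexive sadj
}.

Section ZeroDivisorGraph.
Variable R : finComNzRingType.

Definition nz_zero_divisor (x : R) : bool :=
  (x != 0) && [exists y : R, (y != 0) && (x * y == 0)].

Definition zd_vertex : finType := {x : R | nz_zero_divisor x}.

Definition zd_adj (u v : zd_vertex) : bool :=
  (u != v) && (val u * val v == 0).

Lemma zd_adj_sym : symmetric zd_adj.
Proof. by move=> u v; rewrite /zd_adj eq_sym mulrC. Qed.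

Lemma zd_adj_irrefl : irreflexive zd_adj.
Proof. by move=> u; rewrite /zd_adj eqxx. Qed.

Definition zero_divisor_graph : sgraph := SGraph zd_adj_sym zd_adj_irrefl.

End ZeroDivisorGraph.

(* ['Z_n] is the ring of integers modulo n only when 1 < n. *)
Definition Gamma_Z (n : nat) : sgraph := zero_divisor_graph 'Z_n.

Section CartesianProduct.
Variables G H : sgraph.

Definition cart_adj (p q : G * H) : bool :=
  ((p.1 == q.1) && sadj p.2 q.2) || ((p.2 == q.2) && sadj p.1 q.1).

Lemma cart_adj_sym : symmetric cart_adj.
Proof.
by move=> p q; rewrite /cart_adj !(@sadj_sym _ p.1) !(@sadj_sym _ p.2)
  (eq_sym p.1) (eq_sym p.2).
Qed.

Lemma cart_adj_irrefl : irreflexive cart_adj.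
Proof. by move=> p; rewrite /cart_adj !sadj_irrefl !andbF. Qed.

Definition cartesian_product : sgraph := SGraph cart_adj_sym cart_adj_irrefl.

End CartesianProduct.

Definition weight (G : sgraph) (f : G -> nat) (v : G) : nat :=
  (\sum_(u : G | sadj v u) f u)%N.

(* The first two clauses say that f is a bijection from G onto {1, ..., #|G|}. *)
Definition is_DAML (G : sgraph) (f : G -> nat) : Prop :=
  [/\ injective f,
      (forall k : nat, (exists v : G, f v = k) <-> (1 <= k <= #|G|)%N)
    & injective (weight f)].

Definition admits_DAML (G : sgraph) : Prop :=
  exists f : G -> nat, is_DAML f.

(* Main.v *)
(** Gamma(Z_6) is the path 2 - 3 - 4 and Gamma(Z_{m^2}) is the complete graph on
    the n = m - 1 nonzero multiples of m.  For n >= 4 give the two end columns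
    of the path the labels n, ..., 1 and 2n, ..., n + 1, and the central column
    the labels 2n + 1, ..., 3n.  Inside a column the weights then form an
    arithmetic progression of difference 2 (end columns) or -3 (central column),
    and the column sums, which differ by multiples of n^2, keep the three
    progressions apart.  The case n = 2 needs a labelling of its own. *)

Require Import Defs.
From mathcomp Require Import all_boot all_order all_algebra.
From mathcomp Require Import zify.

Set Implicit Arguments.
Unset Strict Implicit.
Unset Printing Implicit Defensive.
Set Bullet Behavior "Strict Subproofs".

Import GRing.Theory.

Definition sgraph_iso (G H : sgraph) : Prop :=
  exists2 h : G -> H, bijective h & forall u v, sadj (h u) (h v) = sadj u v.

Lemma inj_surj_bij (S T : finType) (h : S -> T) :
  injective h -> (forall y, exists x, h x = y) -> bijective h.
Proof.
move=> h_inj h_surj; apply: (inj_card_bij h_inj).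
rewrite -(card_codom h_inj); apply: subset_leq_card; apply/subsetP => y _.
by have [x <-] := h_surj y; apply: codom_f.
Qed.

(** Relabelling through the inverse [g] only permutes the weights. The labelling can therefore be
    built on ordinals instead of zero-divisors. *)
Lemma sgraph_iso_DAML (G H : sgraph) :
  sgraph_iso G H -> admits_DAML G -> admits_DAML H.
Proof.
case=> h h_bij h_adj [f [f_inj f_onto w_inj]].
have [g hK gK] := h_bij.
have wE v : weight (f \o g) v = weight f (g v).
  rewrite /weight (reindex h) /=; last exact: onW_bij.
  by apply: eq_big => u; rewrite ?hK // -h_adj gK.
exists (f \o g); split.
- exact: inj_comp f_inj (can_inj gK).
- move=> k; rewrite -(bij_eq_card h_bij) -f_onto; split=> -[v <-].
    by exists (g v).
  by exists (h v); rewrite /= hK.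
- by move=> u v; rewrite !wE => /w_inj/(can_inj gK).
Qed.

Lemma cartesian_product_iso (G G' H H' : sgraph) :
  sgraph_iso G G' -> sgraph_iso H H' ->
  sgraph_iso (cartesian_product G H) (cartesian_product G' H').
Proof.
case=> h [g hK gK] h_adj [k [l kK lK] k_adj].
exists (fun p => (h p.1, k p.2)).
  by exists (fun p => (g p.1, l p.2)) => -[x y] /=; rewrite ?hK ?kK ?gK ?lK.
move=> [x y] [x' y']; rewrite /= /cart_adj /= h_adj k_adj.
by rewrite (can_eq hK) (can_eq kK).
Qed.

(** Exclusive or: exactly one of the two vertices is the centre [1], so the path is 0 - 1 - 2. *)
Definition path3_adj (x y : 'I_3) : bool := (x == 1 :> nat) (+) (y == 1 :> nat).

Lemma path3_adj_sym : symmetric path3_adj.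
Proof. by move=> x y; apply: addbC. Qed.

Lemma path3_adj_irrefl : irreflexive path3_adj.
Proof. by move=> x; apply: addbb. Qed.

Definition path3 : sgraph := SGraph path3_adj_sym path3_adj_irrefl.

Definition complete_adj (n : nat) (i j : 'I_n) : bool := i != j.

Lemma complete_adj_sym (n : nat) : symmetric (@complete_adj n).
Proof. by move=> i j; rewrite /complete_adj eq_sym. Qed.

Lemma complete_adj_irrefl (n : nat) : irreflexive (@complete_adj n).
Proof. by move=> i; rewrite /complete_adj eqxx. Qed.

Definition complete (n : nat) : sgraph :=
  SGraph (@complete_adj_sym n) (@complete_adj_irrefl n).

Lemma path3_iso_Gamma_Z6 : sgraph_iso path3 (Gamma_Z 6).
Proof.
have zd (i : 'I_3) : nz_zero_divisor (inZp i.+2 : 'Z_6).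
  (* Modulo 6, the residues 2, 3, 4 are annihilated by 3, 2, 3 respectively. *)
  rewrite /nz_zero_divisor; case: i => [[|[|[|//]]] i_lt] //=;
    apply/existsP; [exists (inZp 3)|exists (inZp 2)|exists (inZp 3)]; by [].
pose h (i : path3) : Gamma_Z 6 := exist _ (inZp i.+2 : 'Z_6) (zd i).
exists h; last first.
  by move=> [[|[|[|//]]] ?] [[|[|[|//]]] ?].
apply: inj_surj_bij.
  move=> [[|[|[|//]]] ?] [[|[|[|//]]] ?] // _; exact: val_inj.
move=> [x x_zd].
have /andP[x_neq0 /existsP[y /andP[y_neq0 xy0]]] := x_zd.
have [k k_lt3 xE] : exists2 k, k < 3 & x = inZp k.+2.
(* The residues 1 and 5 are units: running through [y] finds no nonzero annihilator. *)
{ move: x_neq0 y_neq0 xy0 {x_zd}; case: x => [[|[|[|[|[|[|//]]]]]] x_lt] //.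
  - by case: y => [[|[|[|[|[|[|//]]]]]] y_lt].
  - by exists 0 => //; apply: val_inj.
  - by exists 1 => //; apply: val_inj.
  - by exists 2 => //; apply: val_inj.
  - by case: y => [[|[|[|[|[|[|//]]]]]] y_lt]. }
by exists (Ordinal k_lt3); apply: val_inj; apply: esym.
Qed.

(** The isomorphism sends [i] to [p * i.+1]; any two multiples of [p] have product 0 modulo [p ^ 2],
    so all distinct vertices are adjacent. *)
Lemma complete_iso_Gamma_Z_sqr (p : nat) :
  prime p -> sgraph_iso (complete p.-1) (Gamma_Z (p ^ 2)).
Proof.
move=> p_pr.
have p_gt1 := prime_gt1 p_pr.
have pp_gt1 : 1 < p ^ 2 by nia.
have Zeq0 (x : nat) : ((x%:R : 'Z_(p ^ 2)) == 0)%R = (p ^ 2 %| x).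
  by rewrite -val_eqE /= val_Zp_nat.
have zd (i : 'I_p.-1) : nz_zero_divisor ((p * i.+1)%:R : 'Z_(p ^ 2))%R.
  have i_lt := ltn_ord i.
  rewrite /nz_zero_divisor Zeq0 -mulnn dvdn_pmul2l ?gtnNdvd //=; try lia.
  apply/existsP; exists (p%:R)%R; rewrite -natrM !Zeq0.
  rewrite gtnNdvd //=; try nia.
  by rewrite mulnAC mulnn dvdn_mulr.
pose h (i : complete p.-1) : Gamma_Z (p ^ 2) :=
  exist (fun x : 'Z_(p ^ 2) => nz_zero_divisor x) _ (zd i).
have h_inj : injective h.
  move=> i j /(congr1 val)/(congr1 val) /=; rewrite !val_Zp_nat //.
  have i_lt := ltn_ord i; have j_lt := ltn_ord j.
  rewrite !modn_small; try nia.
  by move=> /eqP; rewrite eqn_pmul2l ?prime_gt0 // eqSS => /eqP/val_inj.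
exists h; last first.
  move=> i j; rewrite /= /zd_adj /= (inj_eq h_inj) -natrM Zeq0.
  by rewrite mulnACA mulnn dvdn_mulr ?andbT.
apply: inj_surj_bij => // v.
have [x xE] : {x : 'Z_(p ^ 2) | x = val v} by exists (val v).
have := valP v; rewrite -xE => /andP[x_neq0 /existsP[y /andP[y_neq0 xy0]]].
move: x_neq0 y_neq0 xy0; rewrite -(natr_Zp x) -(natr_Zp y) -natrM !Zeq0.
move=> x_ndvd y_ndvd xy_dvd.
(* Otherwise [x] is coprime to [p ^ 2], and [p ^ 2 %| x * y] forces [p ^ 2 %| y]. *)
have /dvdnP[k xkE] : p %| x.
  apply: contraNT y_ndvd; rewrite -prime_coprime // => px.
  by rewrite -(@Gauss_dvdr _ x) // coprimeXl.
have x_lt : x < p ^ 2 by have := ltn_ord x; rewrite [in X in _ < X]Zp_cast.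
case: k xkE => [|k] xkE; first by rewrite xkE dvdn0 in x_ndvd.
have k_lt : k < p.-1 by nia.
by exists (Ordinal k_lt); apply: val_inj; rewrite /= mulnC -xkE natr_Zp.
Qed.

(** Inside its column a vertex sees everything but itself; adding its own label completes the column
    sum, which no longer depends on [i], and avoids subtraction. *)
Lemma weight_path3_complete (n : nat) (f : 'I_3 -> nat -> nat) x (i : 'I_n) :
  weight (fun v : cartesian_product path3 (complete n) => f v.1 v.2) (x, i)
    + f x i =
  \sum_(y < 3 | path3_adj x y) f y i + \sum_(j < n) f x j.
Proof.
rewrite /weight /= (bigID (fun u : 'I_3 * 'I_n => x == u.1)) /=.
have -> : \sum_(u | @cart_adj path3 (complete n) (x, i) u && (x == u.1)) f u.1 u.2 =
    \sum_(y | y == x) \sum_(j | j != i) f y j.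
  rewrite pair_big_dep; apply: eq_bigl => -[y j].
  rewrite /cart_adj /= /path3_adj /complete_adj [y == x]eq_sym [j == i]eq_sym.
  by have [->|_] := eqVneq x y; rewrite ?addbb ?andbF ?orbF ?andbT.
have -> : \sum_(u | @cart_adj path3 (complete n) (x, i) u && (x != u.1)) f u.1 u.2 =
    \sum_(y | path3_adj x y) \sum_(j | j == i) f y j.
  rewrite pair_big_dep; apply: eq_bigl => -[y j].
  rewrite /cart_adj /= /path3_adj [j == i]eq_sym.
  by have [->|_] := eqVneq x y; rewrite ?addbb ?andbF ?andbT //= andbC.
rewrite big_pred1_eq [in RHS](bigD1 i) //=.
under [X in _ + X + _]eq_bigr => y _ do rewrite big_pred1_eq.
lia.
Qed.

(** Surjectivity is the pigeonhole principle: [v] to [(f v).-1] is an injection into ['I_#|G|]. *)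
Lemma is_DAML_inj_bounded (G : sgraph) (f : G -> nat) :
  injective f -> (forall v, 1 <= f v <= #|G|) -> injective (weight f) ->
  is_DAML f.
Proof.
move=> f_inj f_bnd w_inj; split=> // k; split=> [[v <-] //|/andP[k_gt0 k_le]].
have f_lt v : (f v).-1 < #|G| by have := f_bnd v; lia.
have g_inj : injective (fun v => Ordinal (f_lt v)).
  move=> u v [] fuv; apply: f_inj.
  by have := f_bnd u; have := f_bnd v; lia.
have k_lt : k.-1 < #|G| by lia.
have /codomP[v [fv]] : Ordinal k_lt \in codom (fun v => Ordinal (f_lt v)).
  by apply: inj_card_onto; rewrite ?card_ord.
by exists v; have := f_bnd v; lia.
Qed.

Lemma card_path3_complete (n : nat) :
  #|cartesian_product path3 (complete n)| = 3 * n.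
Proof. by rewrite card_prod !card_ord. Qed.

Lemma path3_complete2_DAML :
  admits_DAML (cartesian_product path3 (complete 2)).
Proof.
(* The inner lists are the columns; their weights are 3, 7, then 13, 8, then 6, 9. The general
   labels would give weight 8 twice here. *)
pose f (x : 'I_3) i := nth 0 (nth [::] [:: [:: 4; 2]; [:: 1; 3]; [:: 6; 5]] x) i.
exists (fun v : cartesian_product path3 (complete 2) => f v.1 v.2);
  apply: is_DAML_inj_bounded.
- move=> [[[|[|[|//]]] x_lt] [[|[|//]] i_lt]].
  all: move=> [[[|[|[|//]]] y_lt] [[|[|//]] j_lt]] //= _.
  all: congr (_, _); exact: val_inj.
- rewrite card_path3_complete.
  by move=> [[[|[|[|//]]] x_lt] [[|[|//]] i_lt]].
- move=> [x i] [y j] wE.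
  move: (weight_path3_complete f x i) (weight_path3_complete f y j).
  rewrite wE; move: (weight _ _) => w {wE}.
  rewrite !(big_mkcond (path3_adj _)) /= !big_ord_recl !big_ord0 /path3_adj /=.
  case: x => [[|[|[|//]]] x_lt]; case: i => [[|[|//]] i_lt].
  all: case: y => [[|[|[|//]]] y_lt]; case: j => [[|[|//]] j_lt].
  all: rewrite /f /= => E1 E2; try lia.
  all: congr (_, _); exact: val_inj.
Qed.

Lemma path3_complete_DAML (n : nat) :
  4 <= n -> admits_DAML (cartesian_product path3 (complete n)).
Proof.
move=> n_ge4.
pose f (x : 'I_3) i := nth 0 [:: n - i; (2 * n + i).+1; 2 * n - i] x.
(* All column sums are measured against the first one, whose closed form can then stay
   unevaluated. *)
have sum_f (x : 'I_3) : \sum_(i < n) f x i =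
    nth 0 [:: 0; 2 * n * n; n * n] x + \sum_(i < n) (n - i).
  have sum_shift c : \sum_(i < n) (c + (n - i)) = c * n + \sum_(i < n) (n - i).
    by rewrite big_split /= sum_nat_const card_ord mulnC.
  case: x => [[|[|[|//]]] x_lt] //; rewrite /f /= -sum_shift.
    (* Reversing the central column turns [n - i] into [i.+1]. *)
    rewrite [in RHS](reindex_inj rev_ord_inj) /=.
    by apply: eq_bigr => i _; have := ltn_ord i; lia.
  by apply: eq_bigr => i _; have := ltn_ord i; lia.
exists (fun v : cartesian_product path3 (complete n) => f v.1 v.2);
  apply: is_DAML_inj_bounded.
- move=> [[[|[|[|//]]] x_lt] i] [[[|[|[|//]]] y_lt] j]; rewrite /f /= => fE.
  all: have i_lt := ltn_ord i; have j_lt := ltn_ord j; try lia.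
  all: congr (_, _); apply: val_inj => //=; lia.
- rewrite card_path3_complete => -[[[|[|[|//]]] x_lt] i]; rewrite /f /=.
  all: have i_lt := ltn_ord i; lia.
- move=> [x i] [y j] wE.
  move: (weight_path3_complete f x i) (weight_path3_complete f y j).
  rewrite wE !sum_f; move: (weight _ _) (\sum_(k < n) (n - k)) => w S {wE}.
  rewrite !(big_mkcond (path3_adj _)) /= !big_ord_recl !big_ord0 /path3_adj /=.
  have i_lt := ltn_ord i; have j_lt := ltn_ord j.
  case: x => [[|[|[|//]]] x_lt]; case: y => [[|[|[|//]]] y_lt].
  (* Up to the common [S], the weights are [n + 1 + 2 * i], [2 * n ^ 2 + n - 1 - 3 * i] and
     [n ^ 2 + 1 + 2 * i] in columns 0, 1, 2. The ranges of columns 2 and 1 are disjoint once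
     [n ^ 2 + 3 > 4 * n], which holds for [n >= 4] but fails at 3. *)
  all: rewrite /f /= => E1 E2; try nia.
  all: congr (_, _); apply: val_inj => //=; nia.
Qed.

Theorem theorem2p12 (m : nat) (m_prime : prime m) (m_ge3 : 3 <= m) :
  admits_DAML (cartesian_product (Gamma_Z 6) (Gamma_Z (m ^ 2))).
Proof.
apply: sgraph_iso_DAML.
  exact: cartesian_product_iso path3_iso_Gamma_Z6 (complete_iso_Gamma_Z_sqr m_prime).
(* Here [n] is [m - 1]; the value 3 never occurs because 4 is not prime. *)
have [m_ge5|] := leqP 5 m; first by apply: path3_complete_DAML; lia.
case: m m_prime m_ge3 => [|[|[|[|[|//]]]]] // _ _ _.
exact: path3_complete2_DAML.
Qed.
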